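(* Let $z:[0,\infty)\to X_{0+}$ be a solution of the modified Becker–Döring equations obtained by the truncation construction described in the context. Suppose there exist $R'\in[0,R)$ and $t_0\ge0$ such that $$\lambda(t):=\frac{z_1(t)}{N(z(t))}\le R'\qquad\text{for all }t\ge t_0 .$$ Then every element $z^\infty$ of the weak-$*$ $\omega$-limit set of $z$ satisfies $\rho(z^\infty)=\rho_0$.
   Context: Let $(q_l)_{l\ge1}$ be positive with $q_1=1$, $0<R:=\lim_l q_l/q_{l+1}<\infty$, and $\gamma_l>0$ with $\gamma_l/l\to0$. $X=\{z:\sum_l l|z_l|<\infty\}$; a sequence in $X$ converges weak-$*$ iff it is norm-bounded and converges componentwise. $X_{0+}$: nonnegative elements; $\rho(z)=\sum_l lz_l$, $N(z)=\sum_lz_l$, $J_l(z)=\gamma_l\big(z_1z_l-N(z)\frac{q_l}{q_{l+1}}z_{l+1}\big)$ ($l\ge1$), $J_0(z)=-\sum_{l\ge1}J_l(z)$. Fix $y\in X_{0+}$ with $y_1>0$, $\rho_0:=\rho(y)>0$. For $m\ge2$ let $z^{(m)}$ solve $\dot z_l=J_{l-1}(z)-J_l(z)$ ($2\le l\le m-1$), $\dot z_m=J_{m-1}(z)$, $\dot z_1=-J_1(z)-\sum_{l=1}^{m-1}J_l(z)$, $z_l(0)=y_l$ ($l\le m$), $z_l\equiv0$ for $l>m$. The solution $z$ is a continuous $[0,\infty)\to X$ map with $z^{(m_j)}_l\to z_l$ uniformly on compacts for every $l$ along some subsequence $m_j\to\infty$; it satisfies $z(t)\in X_{0+}$, $\rho(z(t))=\rho_0$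 for all $t$, and $\frac{d}{dt}\sum_{n\ge l}z_n(t)=J_{l-1}(z(t))$ for $l\ge2$. The weak-$*$ $\omega$-limit set is $\{w: w=\text{weak-}*\lim_k z(t_k)\text{ for some }t_k\to\infty\}$. *)

(* Defs.v *)
From Stdlib Require Import Reals Lra.
From Coquelicot Require Import Coquelicot.
Open Scope R_scope.

(* Sequences z = (z_l)_{l>=1} are functions nat -> R; component 0 is ignored. *)
Definition sq := nat -> R.

Definition inX (z : sq) : Prop := ex_series (fun k => INR (S k) * Rabs (z (S k))).

Definition Xnorm (z : sq) : R := Series (fun k => INR (S k) * Rabs (z (S k))).

Definition inX0p (z : sq) : Prop := inX z /\ forall l, (1 <= l)%nat -> 0 <= z l.

Definition rho (z : sq) : R := Series (fun k => INR (S k) * z (S k)).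
Definition Ntot (z : sq) : R := Series (fun k => z (S k)).

Definition Jflux (q gamma : nat -> R) (z : sq) (l : nat) : R :=
  gamma l * (z 1%nat * z l - Ntot z * (q l / q (S l)) * z (S l)).

Definition truncated_solution (q gamma : nat -> R) (y : sq) (m : nat)
    (zm : R -> sq) : Prop :=
  (forall t l, (m < l)%nat -> zm t l = 0) /\
  (forall l, (1 <= l <= m)%nat -> zm 0 l = y l) /\
  (forall t, 0 <= t ->
     is_derive (fun s => zm s 1%nat) t
       (- Jflux q gamma (zm t) 1 - sum_n_m (fun l => Jflux q gamma (zm t) l) 1 (m - 1)) /\
     (forall l, (2 <= l <= m - 1)%nat ->
        is_derive (fun s => zm s l) t
          (Jflux q gamma (zm t) (l - 1) - Jflux q gamma (zm t) l)) /\
     is_derive (fun s => zm s m) t (Jflux q gamma (zm t) (m - 1))).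

Definition weak_star_omega_limit (z : R -> sq) (w : sq) : Prop :=
  inX w /\
  exists tk : nat -> R,
    is_lim_seq tk p_infty /\
    (forall k, inX (z (tk k))) /\
    (exists B, forall k, Xnorm (z (tk k)) <= B) /\
    (forall l, (1 <= l)%nat -> is_lim_seq (fun k => z (tk k) l) (w l)).

(* Main.v *)
(** Write [x_l(t) = sum_(n >= l) z_n(t)]. For large [l] and large times the
    hypothesis [lambda <= R' < R] gives, for some [0 < kappa < 1],
    [x_l' <= N gamma_(l-1) c (kappa (x_(l-1) - x_l) - (x_l - x_(l+1)))] with [c > 0].
    Hence the tails [Y_l] of any sequence [d] with [d_(l+1) >= kappa d_l] form a
    stationary supersolution. Taking [d_(l+1) = z_(l+1)(t_0) + kappa d_l]
    with [d_0] large, [Y] dominates [x] at the initial time and at the left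
    boundary, and [sum_l l d_l] is finite since [d] is essentially a convolution
    of [z(t_0)] with a geometric sequence.  The maximum principle, applicable
    because [x_l <= rho_0 / l] vanishes uniformly in time at infinity, gives
    [x_l(t) <= Y_l] for all later times.  So the tails of [sum_l l z_l(t)] are
    small uniformly in [t] and no mass is lost in the limit. *)
Require Import Defs.
From Stdlib Require Import Reals Lra Lia.
From Coquelicot Require Import Coquelicot.
Open Scope R_scope.

(** * Tails and first moments of series *)

Definition tail (a : nat -> R) (l : nat) : R := Series (fun k => a (l + k)%nat).

Definition moment (a : nat -> R) (l : nat) : R := INR l * a l.

Lemma tail_step (a : nat -> R) (l : nat) :
  ex_series a -> tail a l = a l + tail a (S l).
Proof.
intros Ha; unfold tail; rewrite Series_incr_1.
- rewrite Nat.add_0_r; f_equal; apply Series_ext; intros k; f_equal; lia.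
- now apply ex_series_incr_n.
Qed.

Lemma tail_sum_n (a : nat -> R) (n : nat) :
  ex_series a -> sum_n a n + tail a (S n) = tail a 0.
Proof.
intros Ha; induction n as [|n IH].
- rewrite sum_O, (tail_step a 0) by easy; lra.
- rewrite sum_Sn, <- IH, (tail_step a (S n)) by easy; unfold plus; simpl; lra.
Qed.

Lemma is_lim_seq_tail (a : nat -> R) : ex_series a -> is_lim_seq (tail a) 0.
Proof.
intros Ha; apply is_lim_seq_incr_1.
apply is_lim_seq_ext with (fun n => tail a 0 - sum_n a n).
- intros n; rewrite <- (tail_sum_n a n) by easy; lra.
- replace 0 with (tail a 0 - Series a).
  + apply is_lim_seq_minus'; [apply is_lim_seq_const|].
    exact (Series_correct a Ha).
  + change (tail a 0) with (Series a); ring.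
Qed.

Lemma tail_le (a b : nat -> R) (l : nat) :
  (forall n, (l <= n)%nat -> 0 <= a n <= b n) -> ex_series b -> tail a l <= tail b l.
Proof.
intros H Hb; apply Series_le.
- intros k; apply H; lia.
- now apply ex_series_incr_n.
Qed.

Lemma tail_ge0 (a : nat -> R) (l : nat) :
  (forall n, (l <= n)%nat -> 0 <= a n) -> ex_series a -> 0 <= tail a l.
Proof.
intros H Ha.
replace 0 with (tail (fun n => 0 * a n) l).
- apply tail_le; [|easy]; intros n Hn; specialize (H n Hn); lra.
- unfold tail; rewrite (Series_scal_l 0 (fun k => a (l + k)%nat)); ring.
Qed.

Lemma tail_antitone (a : nat -> R) (l n : nat) :
  (forall k, (l <= k)%nat -> 0 <= a k) -> ex_series a -> (l <= n)%nat ->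
  tail a n <= tail a l.
Proof.
intros H Ha Hn; induction Hn as [|n Hn IH]; [lra|].
rewrite (tail_step a n) in IH by easy; specialize (H n Hn); lra.
Qed.

Lemma ex_series_of_moment (a : nat -> R) :
  (forall l, (1 <= l)%nat -> 0 <= a l) -> ex_series (moment a) -> ex_series a.
Proof.
intros H Ha; apply ex_series_incr_1.
apply (ex_series_le (K := R_AbsRing) (V := R_CompleteNormedModule)
         _ (fun k => moment a (S k))).
- intros n; change (Rabs (a (S n)) <= moment a (S n)).
  assert (H1 : 0 <= a (S n)) by (apply H; lia).
  rewrite Rabs_pos_eq by easy; unfold moment.
  assert (1 <= INR (S n)) by (rewrite S_INR; pose proof (pos_INR n); lra).
  nra.
- now apply (ex_series_incr_1 (moment a)).
Qed.

Lemma tail_le_tail_moment (a : nat -> R) (l : nat) :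
  (forall n, (l <= n)%nat -> 0 <= a n) -> ex_series a -> ex_series (moment a) ->
  INR l * tail a l <= tail (moment a) l.
Proof.
intros H Ha Hm; unfold tail; rewrite <- Series_scal_l; apply Series_le.
- intros k; unfold moment.
  assert (0 <= a (l + k)%nat) by (apply H; lia).
  assert (INR l <= INR (l + k)) by (apply le_INR; lia).
  pose proof (pos_INR l); nra.
- now apply ex_series_incr_n.
Qed.

(** Summation by parts writes a moment tail as [INR l * tail c l] plus the sum of all later tails,
    so an ordering of tails passes to moments even where single terms are not ordered. *)
Lemma tail_moment_le (a b : nat -> R) (l : nat) :
  (forall n, (l <= n)%nat -> 0 <= a n) -> (forall n, (l <= n)%nat -> 0 <= b n) ->
  ex_series a -> ex_series b -> ex_series (moment a) -> ex_series (moment b) ->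
  (forall n, (l <= n)%nat -> tail a n <= tail b n) ->
  tail (moment a) l <= tail (moment b) l.
Proof.
intros Ha0 Hb0 Ha Hb Hma Hmb Hab.
(* Summation by parts: [G c l] is the sum of [tail c n] over [n > l]. *)
set (G := fun c n => tail (moment c) n - INR n * tail c n).
assert (G_step : forall c n, ex_series c -> ex_series (moment c) ->
          G c n = G c (S n) + tail c (S n)).
{ intros c n Hc Hmc; unfold G.
  rewrite (tail_step (moment c) n), (tail_step c n), S_INR by easy.
  unfold moment at 1; ring. }
(* By [G_step] the difference [G a - G b] is nondecreasing; it lies below [tail (moment a)], which
   tends to 0. *)
assert (HD : forall n, (l <= n)%nat -> G a l - G b l <= G a n - G b n).
{ intros n Hn; induction Hn as [|n Hn IH]; [lra|].
  rewrite (G_step a n), (G_step b n) in IH by easy.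
  specialize (Hab (S n)); assert (l <= S n)%nat by lia; specialize (Hab H); lra. }
assert (G a l - G b l <= 0).
{ assert (H : Rbar_le (G a l - G b l) 0); [|exact H].
  apply is_lim_seq_le_loc with (fun _ => G a l - G b l) (tail (moment a)).
  - exists l; intros n Hn; specialize (HD n Hn).
    assert (0 <= G b n).
    { pose proof (tail_le_tail_moment b n) as H.
      unfold G; enough (INR n * tail b n <= tail (moment b) n) by lra.
      apply H; try easy; intros k Hk; apply Hb0; lia. }
    assert (0 <= INR n * tail a n).
    { apply Rmult_le_pos; [apply pos_INR|]; apply tail_ge0; [|easy].
      intros k Hk; apply Ha0; lia. }
    unfold G in *; lra.
  - apply is_lim_seq_const.
  - now apply is_lim_seq_tail. }
pose proof (Hab l (le_n l)); pose proof (pos_INR l).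
unfold G in *; nra.
Qed.

(** * Summability by contraction, and the damped comparison sequence *)

Lemma ex_series_bounded (a : nat -> R) (M : R) :
  (forall n, 0 <= a n) -> (forall n, sum_n a n <= M) -> ex_series a.
Proof.
intros Ha HM.
destruct (ex_finite_lim_seq_incr (sum_n a) M) as [l Hl]; [|easy|now exists l].
intros n; rewrite sum_Sn; specialize (Ha (S n)); unfold plus; simpl; lra.
Qed.

(** Summing the recursion bounds each partial sum of [e] by a constant plus [kappa] times the
    previous one, hence by that constant over [1 - kappa]. *)
Lemma ex_series_contraction (f e : nat -> R) (kappa : R) :
  0 <= kappa < 1 -> (forall n, 0 <= e n) -> (forall n, 0 <= f n) -> ex_series f ->
  (forall n, e (S n) <= f n + kappa * e n) -> ex_series e.
Proof.
intros Hk He Hf Hfs Hrec.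
apply ex_series_bounded with ((e 0%nat + Series f) / (1 - kappa)); [easy|].
assert (Hle : forall n, sum_n f n <= Series f).
{ intros n; pose proof (tail_sum_n f n Hfs) as H.
  assert (0 <= tail f (S n)) by (apply tail_ge0; auto).
  change (tail f 0) with (Series f) in H; lra. }
assert (Hs : forall n, sum_n e (S n) <= e 0%nat + sum_n f n + kappa * sum_n e n).
{ induction n as [|n IH].
  - rewrite sum_Sn, !sum_O; unfold plus; simpl; specialize (Hrec 0%nat); lra.
  - rewrite sum_Sn, (sum_Sn f), (sum_Sn e n); unfold plus; simpl.
    specialize (Hrec (S n)); rewrite sum_Sn in IH; unfold plus in IH; simpl in IH; lra. }
intros n; apply Rle_div_r; [lra|].
specialize (Hs n); specialize (Hle n); rewrite sum_Sn in Hs.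
unfold plus in Hs; simpl in Hs; specialize (He (S n)); lra.
Qed.

(** Unfolds to [kappa ^ n * C] plus the convolution of [a], taken from index 1, with the powers of
    [kappa]. The free entry [C] at index 0 serves to dominate at the left boundary. *)
Fixpoint damped (kappa C : R) (a : nat -> R) (n : nat) : R :=
  match n with
  | O => C
  | S k => a n + kappa * damped kappa C a k
  end.

Section Damped.

Variables (kappa C : R) (a : nat -> R).
Hypothesis Hkappa : 0 <= kappa < 1.
Hypothesis HC : 0 <= C.
Hypothesis Ha0 : forall l, (1 <= l)%nat -> 0 <= a l.
Hypothesis Ha : ex_series (moment a).

Let d := damped kappa C a.

Lemma damped_ge_pow n : kappa ^ n * C <= d n.
Proof.
induction n as [|n IH]; [unfold d; simpl; lra|].
change (d (S n)) with (a (S n) + kappa * d n).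
assert (0 <= a (S n)) by (apply Ha0; lia).
simpl; nra.
Qed.

Lemma damped_ge0 n : 0 <= d n.
Proof.
apply Rle_trans with (2 := damped_ge_pow n).
apply Rmult_le_pos; [apply pow_le|]; lra.
Qed.

Lemma damped_ge n : (1 <= n)%nat -> a n <= d n.
Proof.
destruct n as [|n]; [lia|intros _].
change (d (S n)) with (a (S n) + kappa * d n).
pose proof (damped_ge0 n); nra.
Qed.

Lemma ex_series_damped : ex_series d.
Proof.
apply ex_series_contraction with (fun n => a (S n)) kappa; try easy.
- apply damped_ge0.
- intros n; apply Ha0; lia.
- apply (ex_series_incr_1 a); now apply ex_series_of_moment.
Qed.

Lemma ex_series_moment_damped : ex_series (moment d).
Proof.
(* The moments satisfy [(n+1) d_(n+1) = (n+1) a_(n+1) + kappa d_n + kappa n d_n], again a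
   contraction, with the summable [kappa d_n] added to the forcing. *)
apply ex_series_contraction with (fun n => moment a (S n) + kappa * d n) kappa; try easy.
- intros n; apply Rmult_le_pos; [apply pos_INR|apply damped_ge0].
- intros n; apply Rplus_le_le_0_compat.
  + apply Rmult_le_pos; [apply pos_INR|apply Ha0; lia].
  + apply Rmult_le_pos; [lra|apply damped_ge0].
- apply (ex_series_plus (V := R_NormedModule)).
  + now apply (ex_series_incr_1 (moment a)).
  + apply (ex_series_scal (V := R_NormedModule) kappa d); apply ex_series_damped.
- intros n; unfold moment.
  change (d (S n)) with (a (S n) + kappa * d n); rewrite S_INR; lra.
Qed.

End Damped.

(** * One-sided extrema and the maximum principle *)

(** A negative derivative would make [f] exceed [f t] just left of [t]. Only left quotients enter,
    so [t] may be the right end of the time interval. *)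
Lemma is_derive_left_max (f : R -> R) (a t l : R) :
  a < t -> is_derive f t l -> (forall s, a <= s <= t -> f s <= f t) -> 0 <= l.
Proof.
intros Hat Hd Hmax; apply is_derive_Reals in Hd.
destruct (Rle_or_lt 0 l) as [|Hl]; [easy|exfalso].
destruct (Hd (- l)) as [delta Hdelta]; [lra|].
set (h := Rmin (delta / 2) (t - a)).
assert (Hh : 0 < h <= t - a /\ h < delta).
{ pose proof (cond_pos delta); unfold h; repeat split.
  - apply Rmin_glb_lt; lra.
  - apply Rmin_r.
  - pose proof (Rmin_l (delta / 2) (t - a)); lra. }
specialize (Hdelta (- h)); specialize (Hmax (t + - h)).
assert (Hq : 0 <= (f (t + - h) - f t) / - h).
{ replace ((f (t + - h) - f t) / - h) with ((f t - f (t + - h)) / h) by (field; lra).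
  apply Rdiv_le_0_compat; [|easy]; enough (f (t + - h) <= f t) by lra; apply Hmax; lra. }
assert (Hlt : Rabs ((f (t + - h) - f t) / - h - l) < - l).
{ apply Hdelta; [lra|]. rewrite Rabs_Ropp, Rabs_pos_eq; lra. }
apply Rabs_def2 in Hlt; lra.
Qed.

Lemma finite_family_max (f : nat -> R -> R) (a b : R) (p K : nat) :
  a <= b ->
  (forall k, (p <= k)%nat -> forall t, a <= t <= b -> continuity_pt (f k) t) ->
  (p <= K)%nat ->
  exists k s, (p <= k <= K)%nat /\ a <= s <= b /\
    forall n t, (p <= n <= K)%nat -> a <= t <= b -> f n t <= f k s.
Proof.
intros Hab Hc HK; induction HK as [|K HK IH].
- destruct (continuity_ab_maj (f p) a b Hab (Hc p (le_n p))) as [s [Hs1 Hs2]].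
  exists p, s; repeat split; try lia; try apply Hs2.
  intros n t Hn Ht; replace n with p by lia; now apply Hs1.
- destruct IH as [k [s [Hk [Hs H]]]].
  destruct (continuity_ab_maj (f (S K)) a b Hab) as [s' [Hs1 Hs2]]; [apply Hc; lia|].
  destruct (Rle_or_lt (f (S K) s') (f k s)) as [Hle|Hlt].
  + exists k, s; repeat split; try lia; try lra.
    intros n t Hn Ht; destruct (Nat.eq_dec n (S K)) as [->|Hne].
    * specialize (Hs1 t Ht); lra.
    * apply H; [lia|easy].
  + exists (S K), s'; repeat split; try lia; try apply Hs2.
    intros n t Hn Ht; destruct (Nat.eq_dec n (S K)) as [->|Hne].
    * now apply Hs1.
    * apply Rle_trans with (f k s); [apply H; [lia|easy]|lra].
Qed.

(* [decay] makes the supremum of [x - Y] over all [l] and all [t] in a compact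
   interval attained whenever it is positive. *)
Lemma tail_maximum_principle (x x' : nat -> R -> R) (Y : nat -> R) (p : nat) (t0 M : R) :
  (forall l t, (p <= l)%nat -> t0 <= t -> is_derive (x l) t (x' l t)) ->
  (forall l t, (1 <= l)%nat -> t0 <= t -> INR l * x l t <= M) ->
  (forall l, 0 <= Y l) ->
  (1 <= p)%nat ->
  (forall t, t0 <= t -> x p t <= Y p) ->
  (forall l, (p <= l)%nat -> x l t0 <= Y l) ->
  (forall l t, (p < l)%nat -> t0 <= t ->
     x l t - Y l >= x (l - 1)%nat t - Y (l - 1)%nat ->
     x l t - Y l >= x (S l) t - Y (S l) -> x' l t <= 0) ->
  forall l t, (p <= l)%nat -> t0 <= t -> x l t <= Y l.
Proof.
intros Hd decay HY Hp Hbd Hinit Hneg l T Hl HT.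
destruct (Rle_or_lt (x l T) (Y l)) as [|Hlt]; [easy|exfalso].
set (delta := x l T - Y l).
(* The tilt [eps * (t - t0)] makes the inequality strict at a maximum, yet costs less than half the
   excess [delta] up to time [T]. The [+ 1] keeps the divisor positive when [T = t0]. *)
set (eps := delta / 2 / (T - t0 + 1)).
assert (Heps : 0 < eps) by (unfold eps, delta; apply Rdiv_lt_0_compat; lra).
assert (Heps' : eps * (T - t0) < delta / 2).
{ replace (delta / 2) with (eps * (T - t0 + 1)) by (unfold eps; field; lra).
  nra. }
set (v := fun k t => x k t - Y k - eps * (t - t0)).
assert (Hvl : delta / 2 < v l T) by (unfold v, delta in *; lra).
assert (Hdv : forall k t, (p <= k)%nat -> t0 <= t -> is_derive (v k) t (x' k t - eps)).
{ intros k t Hk Ht; unfold v.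
  replace (x' k t - eps) with (x' k t - 0 - eps) by ring.
  apply (is_derive_minus (V := R_NormedModule)).
  - apply (is_derive_minus (V := R_NormedModule)); [now apply Hd|].
    apply (is_derive_const (V := R_NormedModule)).
  - auto_derive; [easy|ring]. }
(* Beyond [K0], decay forces [x n t < delta / 2], so a maximum over the indices up to [K] is a
   maximum over all indices from [p] on. *)
destruct (INR_unbounded (Rabs M / (delta / 2))) as [K0 HK0].
set (K := Nat.max K0 (Nat.max p l)).
destruct (finite_family_max v t0 T p K) as [k [s [Hk [Hs Hmax]]]]; [easy| |lia|].
{ intros k Hk t Ht; apply derivable_continuous_pt.
  exists (x' k t - eps); apply is_derive_Reals, Hdv; [easy|lra]. }
assert (Hks : delta / 2 < v k s).
{ apply Rlt_le_trans with (1 := Hvl); apply Hmax; [lia|lra]. }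
assert (Hall : forall n t, (p <= n)%nat -> t0 <= t <= T -> v n t <= v k s).
{ intros n t Hn Ht; destruct (Nat.le_gt_cases n K) as [Hle|Hgt]; [now apply Hmax|].
  assert (HnK : INR K0 <= INR n) by (apply le_INR; lia).
  assert (HdM : Rabs M < INR n * (delta / 2)).
  { apply (Rmult_lt_compat_r (delta / 2)) in HK0; [|unfold delta; lra].
    unfold Rdiv in HK0 at 1; rewrite Rmult_assoc, Rinv_l in HK0 by (unfold delta; lra).
    assert (INR K0 * (delta / 2) <= INR n * (delta / 2))
      by (apply Rmult_le_compat_r; [unfold delta|]; lra).
    lra. }
  assert (Hn1 : 1 <= INR n) by (apply (le_INR 1); lia).
  assert (Hxn : INR n * x n t <= M) by (apply decay; [lia|lra]).
  pose proof (Rle_abs M).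
  assert (x n t < delta / 2) by (apply (Rmult_lt_reg_l (INR n)); lra).
  assert (0 <= eps * (t - t0)) by (apply Rmult_le_pos; lra).
  specialize (HY n); unfold v in *; lra. }
assert (Hdelta : 0 < delta) by (unfold delta; lra).
assert (Hes : 0 <= eps * (s - t0)) by (apply Rmult_le_pos; lra).
assert (Hkp : (p < k)%nat).
{ destruct (Nat.eq_dec k p) as [->|]; [|lia].
  specialize (Hbd s (proj1 Hs)); unfold v in Hks; lra. }
assert (Hst : t0 < s).
{ destruct (Rle_lt_or_eq_dec t0 s (proj1 Hs)) as [|<-]; [easy|].
  specialize (Hinit k (proj1 Hk)); unfold v in Hks; lra. }
assert (Hx' : 0 <= x' k s - eps).
{ apply (is_derive_left_max (v k) t0 s); [easy|apply Hdv; [lia|lra]|].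
  intros r Hr; apply Hall; [lia|lra]. }
assert (x' k s <= 0); [|lra].
apply Hneg; [easy|lra| |].
(* The tilt is the same for all indices, so at time [s] it cancels and maximality of [v] passes to
   [x - Y]. *)
- pose proof (Hall (k - 1)%nat s) as H; unfold v in H.
  assert (x (k - 1)%nat s - Y (k - 1)%nat - eps * (s - t0) <= x k s - Y k - eps * (s - t0))
    by (apply H; [lia|lra]); lra.
- pose proof (Hall (S k) s) as H; unfold v in H.
  assert (x (S k) s - Y (S k) - eps * (s - t0) <= x k s - Y k - eps * (s - t0))
    by (apply H; [lia|lra]); lra.
Qed.

(** * Passage to the limit under uniform tail bounds *)

Lemma inX0p_moment (a : sq) : inX0p a -> ex_series (moment a).
Proof.
intros [H Hpos]; apply (ex_series_incr_1 (moment a)).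
apply ex_series_ext with (2 := H); intros k.
unfold moment; rewrite Rabs_pos_eq; [easy|apply Hpos; lia].
Qed.

Lemma moment_sum_eq_rho (a : sq) : ex_series (moment a) -> tail (moment a) 0 = rho a.
Proof.
intros H; rewrite tail_step by easy.
change (tail (moment a) 1) with (rho a).
unfold moment; simpl; ring.
Qed.

Lemma is_lim_seq_sum_n (u : nat -> nat -> R) (w : nat -> R) (n : nat) :
  (forall l, is_lim_seq (fun k => u k l) (w l)) ->
  is_lim_seq (fun k => sum_n (u k) n) (sum_n w n).
Proof.
intros H; induction n as [|n IH].
- rewrite sum_O; apply is_lim_seq_ext with (2 := H 0%nat); intros k; now rewrite sum_O.
- rewrite sum_Sn; apply is_lim_seq_ext with (fun k => sum_n (u k) n + u k (S n)).
  + intros k; now rewrite sum_Sn.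
  + now apply is_lim_seq_plus'.
Qed.

(** Componentwise convergence carries each finite partial sum of moments to the limit, where it
    still lies between [M - b (S n)] and [M]; letting [n] grow squeezes the sum to [M]. *)
Lemma rho_lim_of_uniform_tails (u : nat -> sq) (w : sq) (b : nat -> R) (M : R) (p : nat) :
  (forall l, (1 <= l)%nat -> is_lim_seq (fun k => u k l) (w l)) ->
  is_lim_seq b 0 ->
  eventually (fun k => inX0p (u k) /\ rho (u k) = M /\
    forall l, (p <= l)%nat -> tail (moment (u k)) l <= b l) ->
  rho w = M.
Proof.
intros Hw Hb Hu.
assert (Hsum : forall n, is_lim_seq (fun k => sum_n (moment (u k)) n) (sum_n (moment w) n)).
{ intros n; apply is_lim_seq_sum_n; intros [|l]; unfold moment.
  - apply is_lim_seq_ext with (fun _ => 0 * w 0%nat); [intros k; simpl; ring|].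
    apply is_lim_seq_const.
  - apply (is_lim_seq_scal_l _ (INR (S l)) (w (S l))); apply Hw; lia. }
assert (Hbnd : forall n, (p <= S n)%nat -> M - b (S n) <= sum_n (moment w) n <= M).
{ intros n Hn; destruct Hu as [k0 Hu].
  assert (Hk : forall k, (k0 <= k)%nat -> M - b (S n) <= sum_n (moment (u k)) n <= M).
  { intros k Hk; destruct (Hu k Hk) as [Hx [Hr Hl]].
    pose proof (inX0p_moment _ Hx) as Hm.
    pose proof (tail_sum_n (moment (u k)) n Hm) as H.
    rewrite moment_sum_eq_rho, Hr in H by easy.
    specialize (Hl (S n) Hn).
    assert (0 <= tail (moment (u k)) (S n)); [|lra].
    apply tail_ge0; [|easy]; intros j Hj; apply Rmult_le_pos; [apply pos_INR|].
    apply (proj2 Hx); lia. }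
  split.
  - assert (H : Rbar_le (M - b (S n)) (sum_n (moment w) n)); [|exact H].
    apply is_lim_seq_le_loc with (2 := is_lim_seq_const _) (3 := Hsum n).
    exists k0; intros k Hk0; now apply Hk.
  - assert (H : Rbar_le (sum_n (moment w) n) M); [|exact H].
    apply is_lim_seq_le_loc with (2 := Hsum n) (3 := is_lim_seq_const _).
    exists k0; intros k Hk0; now apply Hk. }
assert (Hser : is_series (moment w) M).
{ apply (is_lim_seq_le_le_loc (fun n => M - b (S n)) (sum_n (moment w)) (fun _ => M) M).
  - exists p; intros n Hn; apply Hbnd; lia.
  - replace (Finite M) with (Finite (M - 0)) by (f_equal; ring).
    apply is_lim_seq_minus'; [apply is_lim_seq_const|].
    now apply (is_lim_seq_incr_1 b).
  - apply is_lim_seq_const. }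
rewrite <- moment_sum_eq_rho by (now exists M).
exact (is_series_unique _ _ Hser).
Qed.

(** * Comparison of the Becker-Döring tails and conservation of mass *)

Theorem theorem17
  (q gamma : nat -> R) (Rlim : R) (y : sq) (z : R -> sq)
  (Hq : forall l, (1 <= l)%nat -> 0 < q l)
  (Hq1 : q 1%nat = 1)
  (HR : is_lim_seq (fun l => q (S l) / q (S (S l))) Rlim)
  (HRpos : 0 < Rlim)
  (Hgam : forall l, (1 <= l)%nat -> 0 < gamma l)
  (Hgam0 : is_lim_seq (fun l => gamma (S l) / INR (S l)) 0)
  (Hy : inX0p y) (Hy1 : 0 < y 1%nat) (Hrho0 : 0 < rho y)
  (* z is obtained by the truncation construction *)
  (Htrunc : exists (zm : nat -> R -> sq) (phi : nat -> nat),
      (forall m, (2 <= m)%nat -> truncated_solution q gamma y m (zm m)) /\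
      (forall j, (2 <= phi j)%nat) /\
      (forall j, (phi j < phi (S j))%nat) /\
      (forall l, (1 <= l)%nat -> forall T, 0 <= T -> forall eps, 0 < eps ->
         exists J, forall j, (J <= j)%nat -> forall t, 0 <= t <= T ->
           Rabs (zm (phi j) t l - z t l) < eps))
  (* properties of the solution stated in the context *)
  (Hcont : forall t, 0 <= t -> forall eps, 0 < eps -> exists delta, 0 < delta /\
      forall s, 0 <= s -> Rabs (s - t) < delta ->
        Xnorm (fun l => z s l - z t l) < eps)
  (Hpos : forall t, 0 <= t -> inX0p (z t))
  (Hmass : forall t, 0 <= t -> rho (z t) = rho y)
  (Htail : forall l, (2 <= l)%nat -> forall t, 0 < t ->
      is_derive (fun s => Series (fun k => z s (l + k)%nat)) t
                (Jflux q gamma (z t) (l - 1)))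
  (* the hypothesis of the theorem *)
  (Hlam : exists R' t0, 0 <= R' < Rlim /\ 0 <= t0 /\
      forall t, t0 <= t -> z t 1%nat / Ntot (z t) <= R') :
  forall w, weak_star_omega_limit z w -> rho w = rho y.
Proof.
intros w [_ [tk [Htk [_ [_ Hzw]]]]].
destruct Hlam as [R' [t0 [HR' [Ht0 Hl]]]].
(* The points at one and two thirds between [R'] and [Rlim] separate [lambda] from [q l / q (S l)]
   strictly; [c1] is positive even if [R' = 0], so [kappa] is too. *)
set (c1 := (2 * R' + Rlim) / 3); set (c2 := (R' + 2 * Rlim) / 3).
assert (Hc : R' < c1 < c2 /\ c2 < Rlim) by (unfold c1, c2; lra).
set (kappa := c1 / c2).
assert (Hkappa : 0 < kappa < 1).
{ split; [apply Rdiv_lt_0_compat; lra|apply Rlt_div_l; lra]. }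
assert (Hkc : kappa * c2 = c1) by (unfold kappa; field; lra).
assert (Hp : exists p, (2 <= p)%nat /\ forall l, (p <= l)%nat -> c2 <= q l / q (S l)).
{ apply is_lim_seq_spec in HR.
  assert (He : 0 < Rlim - c2) by lra.
  (* [HR] at [l] concerns [q (S l) / q (S (S l))], hence a shift by one; the second successor gives
     [2 <= p], as [Htail] requires. *)
  destruct (HR (mkposreal _ He)) as [p H]; exists (S (S p)); split; [lia|].
  intros [|l] Hpl; [lia|].
  assert (Hpl' : (p <= l)%nat) by lia.
  specialize (H l Hpl'); simpl in H; apply Rabs_def2 in H; lra. }
destruct Hp as [p [Hp2 Hp]].
assert (Hz0 : forall t l, 0 <= t -> (1 <= l)%nat -> 0 <= z t l).
{ intros t l Ht Hl1; now apply (proj2 (Hpos t Ht)). }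
assert (Hzm : forall t, 0 <= t -> ex_series (moment (z t))).
{ intros t Ht; now apply inX0p_moment, Hpos. }
assert (Hzs : forall t, 0 <= t -> ex_series (z t)).
{ intros t Ht; apply ex_series_of_moment; auto. }
assert (Hdecay : forall l t, (1 <= l)%nat -> 0 <= t -> INR l * tail (z t) l <= rho y).
{ intros l t Hl1 Ht; rewrite <- (Hmass t Ht).
  apply Rle_trans with (tail (moment (z t)) l).
  - apply tail_le_tail_moment; auto; intros n Hn; apply Hz0; [easy|lia].
  - apply (tail_antitone (moment (z t)) 1 l); auto.
    intros k Hk; apply Rmult_le_pos; [apply pos_INR|auto]. }
(* The shift to [t1 > 0] makes the tails differentiable on the closed half-line. *)
set (t1 := t0 + 1).
(* Chosen so that [kappa ^ p * C = rho y], whence [d p] alone dominates the tail of [z t] at [p]. *)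
set (C := rho y / kappa ^ p).
assert (HC : 0 <= C).
{ apply Rdiv_le_0_compat; [lra|apply pow_lt; lra]. }
assert (Hk01 : 0 <= kappa < 1) by lra.
assert (Ht1 : 0 <= t1) by (unfold t1; lra).
set (d := damped kappa C (z t1)).
assert (Hd0 : forall l, 0 <= d l).
{ intros l; apply damped_ge0; auto. }
assert (Hds : ex_series d) by (apply ex_series_damped; auto).
assert (Hdm : ex_series (moment d)) by (apply ex_series_moment_damped; auto).
assert (HN : forall t, t1 <= t -> 0 <= Ntot (z t) /\ z t 1%nat <= c1 * Ntot (z t)).
{ intros t Ht; unfold t1 in *.
  assert (Htt : 0 <= t) by lra.
  assert (Hs : Ntot (z t) = z t 1%nat + tail (z t) 2).
  { change (Ntot (z t)) with (tail (z t) 1); now apply tail_step, Hzs. }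
  assert (H2 : 0 <= tail (z t) 2).
  { apply tail_ge0; auto; intros n Hn; apply Hz0; [easy|lia]. }
  assert (H1 : 0 <= z t 1%nat) by auto.
  split; [lra|].
  (* If [Ntot (z t) = 0], the quotient bound says nothing, but nonnegativity forces [z t 1 = 0]. *)
  destruct (Rle_lt_or_eq_dec 0 (Ntot (z t))) as [Hlt|Heq]; [lra| |nra].
  specialize (Hl t); assert (Ht0' : t0 <= t) by lra; specialize (Hl Ht0').
  apply Rle_div_l in Hl; [nra|easy]. }
assert (Hcmp : forall l t, (p <= l)%nat -> t1 <= t -> tail (z t) l <= tail d l).
{ apply (tail_maximum_principle (fun l t => tail (z t) l)
           (fun l t => Jflux q gamma (z t) (l - 1)) (tail d) p t1 (rho y)).
  - intros l t Hpl Ht; apply Htail; [lia|unfold t1 in Ht; lra].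
  - intros l t Hl1 Ht; apply Hdecay; [easy|lra].
  - intros l; apply tail_ge0; auto.
  - lia.
  - intros t Ht; apply Rle_trans with (rho y).
    + assert (Hp1 : 1 <= INR p) by (apply (le_INR 1); lia).
      assert (H0 : 0 <= tail (z t) p).
      { apply tail_ge0; [intros n Hn; apply Hz0; [lra|lia]|apply Hzs; lra]. }
      assert (INR p * tail (z t) p <= rho y) by (apply Hdecay; [lia|lra]).
      nra.
    + assert (Hdp : kappa ^ p * C <= d p) by (apply damped_ge_pow; auto).
      replace (kappa ^ p * C) with (rho y) in Hdp
        by (unfold C; field; apply pow_nonzero; lra).
      rewrite tail_step by easy.
      assert (0 <= tail d (S p)) by (apply tail_ge0; auto); lra.
  - intros l Hpl; apply tail_le; [|easy].
    intros n Hn; split; [apply Hz0; [easy|lia]|].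
    apply damped_ge; auto; lia.
  - intros [|l] t Hpl Ht; [lia|].
    replace (S l - 1)%nat with l by lia.
    rewrite (tail_step (z t) l), (tail_step d l), (tail_step (z t) (S l)),
      (tail_step d (S l)) by (auto; apply Hzs; lra).
    intros Hprev Hnext.
    (* Differences of adjacent tails are single terms: the left neighbour gives [z_l <= d_l], the
       right one [z_(l+1) >= d_(l+1) >= kappa d_l]. *)
    assert (Hzl : z t l <= d l) by lra.
    assert (HzS : kappa * d l <= z t (S l)).
    { enough (kappa * d l <= d (S l)) by lra.
      change (d (S l)) with (z t1 (S l) + kappa * d l).
      assert (0 <= z t1 (S l)) by (apply Hz0; [easy|lia]); lra. }
    destruct (HN t Ht) as [HN0 HN1].
    assert (Hr : c2 <= q l / q (S l)) by (apply Hp; lia).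
    assert (Hg : 0 < gamma l) by (apply Hgam; lia).
    assert (Hzl0 : 0 <= z t l) by (apply Hz0; [lra|lia]).
    (* Since [kappa * c2 = c1], the same quantity [c1 * Ntot (z t) * d l] bounds the gain term from
       above and the loss term from below, so the flux is nonpositive. *)
    assert (H1 : z t 1%nat * z t l <= c1 * Ntot (z t) * d l).
    { apply Rmult_le_compat; try easy; apply Hz0; [lra|lia]. }
    assert (H2 : Ntot (z t) * c2 * (kappa * d l)
                 <= Ntot (z t) * (q l / q (S l)) * z t (S l)).
    { apply Rmult_le_compat; try easy.
      - apply Rmult_le_pos; lra.
      - apply Rmult_le_pos; [lra|apply Hd0].
      - now apply Rmult_le_compat_l. }
    replace (Ntot (z t) * c2 * (kappa * d l)) with (c1 * Ntot (z t) * d l) in H2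
      by (rewrite <- Hkc; ring).
    unfold Jflux; nra. }
apply (rho_lim_of_uniform_tails (fun k => z (tk k)) w (tail (moment d)) (rho y) p).
- easy.
- now apply is_lim_seq_tail.
- apply is_lim_seq_spec in Htk; destruct (Htk t1) as [k0 Hk0].
  exists k0; intros k Hk; specialize (Hk0 k Hk).
  assert (Htk0 : 0 <= tk k) by lra.
  split; [now apply Hpos|split; [now apply Hmass|]].
  (* The comparison orders only tails of [z] and [d]; it becomes here a mass bound independent of
     [k]. *)
  intros l Hpl; apply tail_moment_le; auto.
  + intros n Hn; apply Hz0; [easy|lia].
  + intros n Hn; apply Hcmp; [lia|lra].
Qed.
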